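(* Let $m$ be an odd positive integer, $n$ a positive integer, and let $\mathcal{C}$ be an order $m$ dimension $n$ symmetric Cauchy tensor with generating vector $c=(c_1,\ldots,c_n)\in\mathbb{R}^n$ satisfying $c_i>0$ for all $i\in[n]$. If $c_1,\ldots,c_n$ are mutually distinct, then $\mathcal{C}$ has no zero Z-eigenvalue, i.e. $0$ is not a Z-eigenvalue of $\mathcal{C}$.
   Context: $[n]=\{1,\ldots,n\}$. An order $m$ dimension $n$ symmetric Cauchy tensor with generating vector $c=(c_1,\ldots,c_n)\in\mathbb{R}^n$ is the real tensor $\mathcal{C}=(c_{i_1\cdots i_m})$ with entries $c_{i_1i_2\cdots i_m}=\frac{1}{c_{i_1}+c_{i_2}+\cdots+c_{i_m}}$, $i_1,\ldots,i_m\in[n]$, where it is assumed that $c_{i_1}+\cdots+c_{i_m}\neq 0$ for all $i_1,\ldots,i_m\in[n]$. A real number $\lambda$ is a Z-eigenvalue of an order $m$ dimension $n$ tensor $\mathcal{A}=(a_{i_1\cdots i_m})$ if there is $x\in\mathbb{R}^n$ with $\mathcal{A}x^{m-1}=\lambda x$ and $x^Tx=1$, where $(\mathcal{A}x^{m-1})_i=\sum_{i_2,\ldots,i_m\in[n]}a_{ii_2\cdots i_m}x_{i_2}\cdots x_{i_m}$. *)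

(* Defs.v *)
From mathcomp Require Import all_boot all_order all_algebra.
From mathcomp Require Import reals.

Set Implicit Arguments.
Unset Strict Implicit.
Unset Printing Implicit Defensive.

Import Order.TTheory GRing.Theory Num.Theory.
Local Open Scope ring_scope.

(* Real tensors of order m and dimension n: t = [tuple i_1; ...; i_m] is
   sent to the entry a_{i_1 ... i_m}; indices run over 0, ..., n - 1. *)
Definition tensor (R : realType) (m n : nat) : Type :=
  {ffun m.-tuple 'I_n -> R}.

(* The column vector A x^{m-1}. The sum over (i_2, ..., i_m) is taken over the
   m-tuples t with first entry i, so that behead t = (i_2, ..., i_m); this
   avoids casts between m and (m - 1) + 1. Only m > 0 is meaningful. *)
Definition tensor_apply (R : realType) (m n : nat)
    (A : tensor R m n) (x : 'cV[R]_n) : 'cV[R]_n :=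
  \col_i \sum_(t : m.-tuple 'I_n | ohead t == Some i)
    A t * \prod_(j <- behead t) x j 0.

Definition is_Z_eigenvalue (R : realType) (m n : nat)
    (A : tensor R m n) (lambda : R) : Prop :=
  exists x : 'cV[R]_n,
    tensor_apply A x = lambda *: x /\ x^T *m x = 1%:M.

Definition is_Cauchy_tensor (R : realType) (m n : nat)
    (c : 'cV[R]_n) (C : tensor R m n) : Prop :=
  forall t : m.-tuple 'I_n,
    \sum_(j <- t) c j 0 != 0 /\ C t = 1 / \sum_(j <- t) c j 0.

(* Main.v *)
Require Import Defs.
From mathcomp Require Import all_boot all_order all_algebra.
From mathcomp Require Import reals.
From mathcomp Require Import ring.
Set Implicit Arguments.
Unset Strict Implicit.
Unset Printing Implicit Defensive.
Import Order.TTheory GRing.Theory Num.Theory.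
Local Open Scope ring_scope.

(** Write m = 2k + 1. Row i of C x^(m-1) = 0, summed over pairs (J, K) of
    k-tuples, says that the Cauchy quadratic form
    sum_(J, K) y_J y_K / (d_J + d_K) vanishes, where y_J = prod_(j in J) x_j and
    d_J = c_i / 2 + sum_(j in J) c_j > 0. The identity
    1/(a+b) = 2e/((a+e)(b+e)) + (a-e)(b-e)/((a+b)(a+e)(b+e))
    shows that the form does not increase when y_J is multiplied by
    (d_J - e)/(d_J + e), an operation which kills the terms with d_J = e.
    If x <> 0, let j maximise c_j among the indices with x_j <> 0; as the c_j
    are distinct, J0 = (j, ..., j) is the only tuple with y_J <> 0 whose d_J is
    d_J0. Killing all the others leaves a positive multiple of y_J0^2. *)

Section CauchyForm.

Variables (R : realFieldType) (I : finType) (d : I -> R).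
Hypothesis d_gt0 : forall a, 0 < d a.

Definition cauchy_form (y : I -> R) : R :=
  \sum_a \sum_b y a * y b / (d a + d b).

Lemma eq_cauchy_form (y z : I -> R) :
  y =1 z -> cauchy_form y = cauchy_form z.
Proof.
move=> yz; apply: eq_bigr => a _; apply: eq_bigr => b _.
by rewrite !yz.
Qed.

Lemma cauchy_form_step (e : R) (y : I -> R) : 0 < e ->
  cauchy_form (fun a => y a * ((d a - e) / (d a + e))) <= cauchy_form y.
Proof.
move=> e0; rewrite -subr_ge0 /cauchy_form -sumrB.
(* The first term of the identity separates the variables: weighted by [y a * y b] and summed over
   both indices, it becomes a square. *)
have -> : \sum_a (\sum_b y a * y b / (d a + d b) -
    \sum_b y a * ((d a - e) / (d a + e)) * (y b * ((d b - e) / (d b + e)))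
      / (d a + d b)) =
  2 * e * (\sum_a y a / (d a + e)) ^+ 2.
  rewrite expr2 mulr_suml mulr_sumr; apply: eq_bigr => a _.
  rewrite -sumrB !mulr_sumr; apply: eq_bigr => b _.
  have := d_gt0 a; have := d_gt0 b => b0 a0.
  by field; rewrite !lt0r_neq0 ?addr_gt0.
by rewrite mulr_ge0 ?sqr_ge0 // mulr_ge0 ?ler0n // ltW.
Qed.

Lemma cauchy_form_prod (s : seq R) (y : I -> R) : all (fun e => 0 < e) s ->
  cauchy_form (fun a => y a * \prod_(e <- s) ((d a - e) / (d a + e)))
    <= cauchy_form y.
Proof.
elim: s y => [|e s IHs] y /=.
  by move=> _; rewrite (@eq_cauchy_form _ y) // => a; rewrite big_nil mulr1.
case/andP=> e0 s0; apply: le_trans (cauchy_form_step y e0).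
apply: le_trans (IHs _ s0); rewrite le_eqVlt; apply/orP; left; apply/eqP.
by apply: eq_cauchy_form => a; rewrite big_cons mulrA.
Qed.

Lemma cauchy_form_gt0 (y : I -> R) (a0 : I) : y a0 != 0 ->
  (forall a, a != a0 -> y a != 0 -> d a != d a0) -> 0 < cauchy_form y.
Proof.
(* By [isol], [s] contains [d a] for every other [a] with [y a != 0], so those terms get a zero
   factor; as [d a0] is left out, no factor vanishes at [a0]. *)
move=> y0 isol; pose s := [seq d a | a <- enum I & d a != d a0].
have s0 : all (fun e => 0 < e) s by apply/allP => _ /mapP[a _ ->].
apply: lt_le_trans (cauchy_form_prod y s0).
set z := fun a => _.
have z0 a : a != a0 -> z a = 0.
  move=> aa0; rewrite /z; have [->|ya] := eqVneq (y a) 0; first by rewrite mul0r.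
  have das : d a \in s.
    by apply: map_f; rewrite mem_filter mem_enum andbT isol.
  by rewrite (big_rem _ das) /= subrr !mul0r mulr0.
have za0 : z a0 != 0.
  rewrite /z mulf_neq0 // prodf_seq_neq0; apply/allP => e es /=.
  have e0 := allP s0 _ es; case/mapP: (es) => a; rewrite mem_filter.
  case/andP=> da _ ea; rewrite mulf_neq0 ?invr_neq0 ?subr_eq0 //.
    by rewrite ea eq_sym.
  by rewrite lt0r_neq0 ?addr_gt0.
rewrite /cauchy_form (bigD1 a0) //= [X in _ + X]big1 => [|a aa0]; last first.
  by apply: big1 => b _; rewrite z0 // !mul0r.
rewrite (bigD1 a0) //= big1 => [|b ba0]; last by rewrite (z0 b) // mulr0 mul0r.
by rewrite !addr0 divr_gt0 ?addr_gt0 // -expr2 exprn_even_gt0.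
Qed.

End CauchyForm.

Lemma sum_tuple_head_cat (V : nmodType) (n k l : nat) (i : 'I_n)
    (F : (k + l).+1.-tuple 'I_n -> V) :
  \sum_(t : (k + l).+1.-tuple 'I_n | ohead t == Some i) F t =
  \sum_(J : k.-tuple 'I_n) \sum_(K : l.-tuple 'I_n) F [tuple of i :: J ++ K].
Proof.
pose h (p : k.-tuple 'I_n * l.-tuple 'I_n) := [tuple of i :: p.1 ++ p.2].
(* The [nseq] defaults are never returned, since both pieces have the right size; [i] merely
   witnesses that the tuple types are inhabited. *)
pose h' (t : (k + l).+1.-tuple 'I_n) :=
  (insubd [tuple of nseq k i] (take k (behead t)),
   insubd [tuple of nseq l i] (drop k (behead t))).
rewrite pair_big /= (reindex h) /=; first by apply: eq_big => //= p; rewrite eqxx.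
exists h' => [[J K] _ | t].
  rewrite /h /h'; congr (_, _); apply: val_inj => /=.
    by rewrite take_size_cat ?size_tuple // val_insubd size_tuple eqxx.
  by rewrite drop_size_cat ?size_tuple // val_insubd size_tuple eqxx.
rewrite inE => ht; apply: val_inj => /=.
have st : size (behead t) = (k + l)%N by rewrite size_behead size_tuple.
rewrite !val_insubd size_drop size_takel st ?leq_addr // addKn !eqxx cat_take_drop.
by case: {st}(val t) ht => //= a s /eqP[->].
Qed.

(** Each entry of [J] lies in the support of [x], so it contributes at most [c j]; equality of the
    sums forces equality term by term, and injectivity of [c] then makes every entry [j]. *)
Lemma sum_max_isolated (R : realFieldType) (n k : nat) (c x : 'I_n -> R)
    (j : 'I_n) (J : k.-tuple 'I_n) : injective c ->
  (forall i, x i != 0 -> c i <= c j) ->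
  \prod_(i <- J) x i != 0 -> \sum_(i <- J) c i = \sum_(i <- nseq k j) c i ->
  J = [tuple of nseq k j].
Proof.
move=> cinj cmax; rewrite prodf_seq_neq0 => /allP xJ.
rewrite (big_tuple _ _ J) (big_tuple _ _ [tuple of nseq k j]) => /eqP.
have le (l : 'I_k) : true ->
  c (tnth J l) <= c (tnth [tuple of nseq k j] l) ?= iff (tnth J l == j).
  move=> _; rewrite tnth_nseq; split; last exact: inj_eq.
  exact/cmax/(xJ _ (mem_tnth l J)).
rewrite (leif_sum le).2 => /forallP Jj.
by apply: eq_from_tnth => l; rewrite tnth_nseq; apply/eqP/Jj.
Qed.

Theorem theorem3p3 (R : realType) (m n : nat) (hm : odd m) (hn : (0 < n)%N)
    (c : 'cV[R]_n) (C : tensor R m n) (hC : is_Cauchy_tensor c C)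
    (hpos : forall i : 'I_n, 0 < c i 0)
    (hdist : forall i j : 'I_n, i != j -> c i 0 != c j 0) :
  ~ is_Z_eigenvalue C 0.
Proof.
have [k mE] : exists k, m = (k + k).+1.
  by exists m./2; rewrite addnn -[LHS]odd_double_half hm.
subst m; case=> x; rewrite scale0r => -[Cx0 x1].
have [i xi] : exists i, x i 0 != 0.
  apply/existsP; apply: contraT; rewrite negb_exists => /forallP x0.
  have : (x^T *m x) 0 0 = 0.
    by rewrite mxE big1 // => l _; move/eqP: (negbNE (x0 l)) => ->; rewrite mulr0.
  by rewrite x1 mxE => /eqP; rewrite oner_eq0.
case: (@Order.TotalTheory.arg_maxP _ _ _ i (fun l => x l 0 != 0)
  (fun l => c l 0) xi) => j xj jmax.
have cinj : injective (fun l => c l 0).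
  by move=> a b /eqP; apply: contraTeq => /hdist.
(* Halving [c i 0] makes [d J + d K] the Cauchy denominator at [i :: J ++ K]; it also keeps [d J]
   positive when [k = 0]. *)
pose d (J : k.-tuple 'I_n) := c i 0 / 2 + \sum_(l <- J) c l 0.
pose y (J : k.-tuple 'I_n) := \prod_(l <- J) x l 0.
have d0 J : 0 < d J.
  by rewrite ltr_wpDr ?divr_gt0 // sumr_ge0 // => l _; apply: ltW.
have : 0 < cauchy_form d y.
  apply: (cauchy_form_gt0 d0 (a0 := [tuple of nseq k j])) => [|J JJ0 yJ].
    by rewrite prodf_seq_neq0; apply/allP => l /nseqP[-> _].
  apply: contraNneq JJ0 => /addrI eqd; apply/eqP.
  exact: (sum_max_isolated cinj jmax yJ eqd).
suff -> : cauchy_form d y = 0 by rewrite ltxx.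
(* Only row [i] is needed: its [k + k] free indices split into the pair [J], [K], which turns it
   into the quadratic form. *)
have := congr1 (fun v : 'cV_n => v i 0) Cx0; rewrite !mxE sum_tuple_head_cat => <-.
apply: eq_bigr => J _; apply: eq_bigr => K _.
rewrite (hC _).2 /= big_cat big_cons big_cat /= mul1r mulrC /d.
by congr (_^-1 * _); field.
Qed.
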